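(* Let $\lambda,m,n$ be positive integers and $T$ a 2-factor type. If $OP(\lambda mK_n;T)$ has a solution, then $OP(\lambda K_{n\times m};mT)$ has a solution.
   Context: $\lambda K_n$: complete multigraph on $n$ vertices with $\lambda$ parallel edges per pair; $\lambda K_{n\times m}$: complete $\lambda$-fold $n$-partite multigraph with parts of size $m$. A 2-factor has type $[c_1,\ldots,c_t]$ if it is a disjoint union of cycles of lengths $c_1,\ldots,c_t$; $mT=[mx:x\in T]$. A 2-factorization of an $r$-regular graph is a decomposition into $\lfloor r/2\rfloor$ 2-factors plus a single 1-factor if $r$ is odd. $OP(\mathcal{G};T)$ (Oberwolfach Problem) asks whether $\mathcal{G}$ admits a 2-factorization in which every 2-factor has type $T$; it ''has a solution'' if such a 2-factorization exists. *)

(* Defs.v *)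
From mathcomp Require Import all_boot.

Set Implicit Arguments.
Unset Strict Implicit.
Unset Printing Implicit Defensive.

(* Parallel edges are distinct elements of [edge] with the same ends; loops
   are excluded by [card_ends]. *)
Record multigraph := Multigraph {
  vertex : finType;
  edge : finType;
  ends : edge -> {set vertex};
  card_ends : forall e, #|ends e| == 2
}.

Section LambdaFold.
Variables (lam : nat) (V : finType) (adj : rel V).

Definition adj_pair (A : {set V}) : bool :=
  [exists u, exists v, [&& u != v, adj u v & A == [set u; v]]].

Definition fold_edge : Type := ({A : {set V} | adj_pair A} * 'I_lam)%type.

Definition fold_ends (e : fold_edge) : {set V} := val e.1.

Lemma card_fold_ends (e : fold_edge) : #|fold_ends e| == 2.
Proof.
have /existsP[u /existsP[v /and3P[uv _ /eqP eA]]] := valP e.1.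
by rewrite /fold_ends eA cards2 uv.
Qed.

(* Every adjacent pair of the simple graph [adj] is joined by [lam] edges. *)
Definition lambda_fold : multigraph := Multigraph card_fold_ends.

End LambdaFold.

Definition complete_multigraph (lam n : nat) : multigraph :=
  lambda_fold lam (fun u v : 'I_n => u != v).

(* The vertex (i, a) lies in the i-th of the n parts, each of size m. *)
Definition complete_multipartite_multigraph (lam n m : nat) : multigraph :=
  lambda_fold lam (fun u v : 'I_n * 'I_m => u.1 != v.1).

Section Factors.
Variable G : multigraph.

(* Spanning subgraphs are represented by their edge sets. *)
Definition degree_in (F : {set edge G}) (v : vertex G) : nat :=
  #|[set e in F | v \in ends e]|.

Definition regular_in (F : {set edge G}) (r : nat) : Prop :=
  forall v, degree_in F v = r.

Definition regular (r : nat) : Prop := regular_in [set: edge G] r.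

Definition one_factor (F : {set edge G}) : Prop := regular_in F 1.

Definition two_factor (F : {set edge G}) : Prop := regular_in F 2.

(* The sequence (v_0, e_0), ..., (v_(c-1), e_(c-1)) stands for the cycle of
   length c in which e_i joins v_i to v_(i+1), indices modulo c.  Two parallel
   edges form a cycle of length 2. *)
Definition is_cycle (c : seq (vertex G * edge G)) : bool :=
  [&& 1 < size c, uniq (unzip1 c), uniq (unzip2 c) &
      cycle (fun p q => ends p.2 == [set p.1; q.1]) c].

(* Types are unordered lists, hence [perm_eq]. *)
Definition has_type (F : {set edge G}) (T : seq nat) : Prop :=
  exists cs : seq (seq (vertex G * edge G)),
    [/\ all is_cycle cs,
        perm_eq [seq size c | c <- cs] T,
        uniq (unzip1 (flatten cs)),
        forall v, v \in unzip1 (flatten cs)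
      & F = [set e in unzip2 (flatten cs)]].

Definition decomposition (s : seq {set edge G}) : Prop :=
  forall e, count (fun F : {set edge G} => e \in F) s = 1.

(* [Fs] lists the 2-factors; the 1-factor needed for odd r is left implicit. *)
Definition two_factorization (r : nat) (Fs : seq {set edge G}) : Prop :=
  [/\ size Fs = r./2,
      forall F, F \in Fs -> two_factor F
    & if odd r then exists2 I, one_factor I & decomposition (I :: Fs)
      else decomposition Fs].

Definition OP_has_solution (T : seq nat) : Prop :=
  exists r (Fs : seq {set edge G}),
    [/\ regular r,
        two_factorization r Fs
      & forall F, F \in Fs -> has_type F T].

End Factors.

(* Multigraphs may contain 2-cycles, so entries equal to 2 are allowed. *)
Definition two_factor_type (T : seq nat) : bool := all (fun c => 1 < c) T.

(* Main.v *)
Require Import Defs.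
From mathcomp Require Import all_boot.
Set Implicit Arguments.
Unset Strict Implicit.
Unset Printing Implicit Defensive.

(* Amalgamation and detachment.  Replace every edge of lam m K_n by m parallel
   edges, so that a cycle of a 2-factor becomes a closed trail that runs m times
   around it, and then split every vertex u, of weight m, into m vertices by
   detaching one vertex x' of weight 1 at a time.  When x has weight g, the trails
   through x are cut at x into loops; x' must receive a fraction 1/g of the edges
   between x and any other vertex, and two edge ends from each trail.  If these
   two come from different loops of the trail, the rest can be reconnected at x
   into a single closed trail.  A fractional choice (1/g of every edge end) exists,
   hence by Hall's theorem an integral one.  At the end every trail of length m c
   visits no vertex twice. *)

(** * Fair selections in bipartite graphs *)

Section Matching.
Variables (L R : finType).

(** Induction on the size of [A]. If a nonempty proper subset [B] meets Hall's bound with equality,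
    [B] and its complement are matched separately, the neighbours of [B] being reserved for [B].
    Otherwise every such subset has slack, and any [x0] may be sent to any neighbour of positive
    capacity. The element [y0] only provides a map when [A] is empty. *)
Lemma hall_capacity (y0 : R) (N : L -> pred R) (A : {set L}) (cap : R -> nat) :
    (forall B : {set L}, B \subset A ->
       #|B| <= \sum_(y | [exists x in B, N x y]) cap y) ->
  exists f : L -> R, (forall x, x \in A -> N x (f x)) /\
    (forall y, #|[set x in A | f x == y]| <= cap y).
Proof.
have [n] := ubnP #|A|; elim: n => // n IHn in A cap * => leAn hallA.
have [->|[x0 x0A]] := set_0Vmem A.
  exists (fun=> y0); split=> [x|y]; first by rewrite inE.
  by rewrite (_ : [set _ in _ | _] = set0) ?cards0 //; apply/setP=> x; rewrite !inE.
pose NB (B : {set L}) y := [exists x in B, N x y].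
have NBU B C y : NB (B :|: C) y = NB B y || NB C y.
  apply/exists_inP/orP => [[x /setUP[] xB xy]|].
  - by left; apply/exists_inP; exists x.
  - by right; apply/exists_inP; exists x.
  - by case=> /exists_inP[x xB xy]; exists x; rewrite // inE xB ?orbT.
have [/existsP[B /and3P[ltBA nzB tightB]]|] :=
  boolP [exists B : {set L}, [&& B \proper A, B != set0
                                 & #|B| == \sum_(y | NB B y) cap y]].
  have sBA := proper_sub ltBA.
  have [|C sCB|f [fN fcap]] := IHn B cap.
  - exact: leq_trans (proper_card ltBA) _.
  - by apply: hallA; apply: subset_trans sBA.
  have cAB : #|A :\: B| < #|A|.
    rewrite -(cardsID B A) (setIidPr sBA) -[X in X < _]add0n ltn_add2r card_gt0 //.
  have [||h [hN hcap]] := IHn (A :\: B) (fun y => if NB B y then 0 else cap y).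
  - exact: leq_trans cAB _.
  (* Hall's condition for [C] under the reduced capacities follows from that for [B :|: C], since
     the neighbours of [B] account for exactly [#|B|]. *)
  - move=> C sC; rewrite -(leq_add2l #|B|).
    have dBC : [disjoint B & C].
      rewrite disjoint_sym; apply: disjointWl sC _.
      by rewrite -setI_eq0 setIC; apply/eqP/setP=> x; rewrite !inE; case: (x \in B).
    rewrite -cardsUI (disjoint_setI0 dBC) cards0 addn0 (eqP tightB).
    apply: leq_trans (hallA _ _) _; first by rewrite subUset sBA (subset_trans sC) ?subsetDl.
    rewrite (bigID (NB B)) /=; apply: leq_add.
      rewrite (eq_bigl (NB B)) // => y; rewrite [X in X && _](NBU B C y).
      by case: (NB B y); rewrite ?andbF.
    rewrite [X in _ <= X](bigID (NB B)) /= -[X in X <= _]add0n leq_add //.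
    rewrite (eq_bigl (fun y => NB C y && ~~ NB B y)) => [|y].
      by apply: leq_sum => y /andP[_ /negbTE ->].
    by rewrite [X in X && _](NBU B C y); case: (NB B y); rewrite ?andbF.
  exists (fun x => if x \in B then f x else h x); split=> [x xA|y].
    case: ifP => [|xB]; first exact: fN.
    by apply: hN; rewrite inE xB.
  rewrite (_ : [set _ in A | _] =
     [set x in B | f x == y] :|: [set x in A :\: B | h x == y]); last first.
    apply/setP=> x; rewrite !inE; have := subsetP sBA x.
    by case: (x \in B) => [-> //|_]; rewrite ?orbF.
  apply: leq_trans (leq_card_setU _ _) _.
  have [NBy|nNBy] := boolP (NB B y).
    by have := hcap y; rewrite NBy leqn0 => /eqP->; rewrite addn0.
  rewrite (_ : [set x in B | _] = set0) ?cards0 ?add0n.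
    by have := hcap y; rewrite (negbTE nNBy).
  apply/setP=> x; rewrite !inE; apply/negP=> /andP[xB /eqP fx].
  by case/negP: nNBy; apply/exists_inP; exists x; rewrite // -fx fN.
rewrite negb_exists => /forallP slack.
have: 0 < \sum_(y | NB [set x0] y) cap y.
  by apply: leq_trans (hallA [set x0] _); rewrite ?cards1 ?sub1set.
rewrite lt0n sum_nat_eq0 negb_forall => /existsP[y1]; rewrite negb_imply.
case/andP=> /exists_inP[x1 /set1P->] x0y1 cap1.
have [||f [fN fcap]] := IHn (A :\ x0) (fun y => cap y - (y == y1)).
- by have := cardsD1 x0 A; rewrite x0A add1n => <-.
- move=> C sC; have [->|nzC] := eqVneq C set0; first by rewrite cards0.
  have ltCA : C \proper A.
    by apply/properP; split; [apply: subset_trans sC (subsetDl _ _)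
      | exists x0 => //; apply/negP=> /(subsetP sC); rewrite !inE eqxx].
  (* As [C] avoids [x0], it is a proper subset of [A]; the strict inequality that the slack gives
     absorbs the unit of capacity lost at [y1]. *)
  have := slack C; rewrite ltCA nzC /= => neq.
  have := hallA C (proper_sub ltCA); rewrite leq_eqVlt (negbTE neq) /= => lt.
  rewrite -ltnS; apply: leq_trans lt _.
  have [NCy|nNCy] := boolP (NB C y1).
    rewrite (bigD1 y1) //= [X in _ <= X.+1](bigD1 y1) //= eqxx subn1.
    rewrite -addSn prednK ?lt0n // leq_add2l leq_sum // => y /andP[_ /negbTE->].
    by rewrite subn0.
  apply: leqW; apply: leq_sum => y NCy.
  by case: eqP NCy nNCy => [->|]; rewrite ?subn0 // /NB /= => ->.
exists (fun x => if x == x0 then y1 else f x); split=> [x xA|y].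
  by case: eqP => [-> //|/eqP neq]; apply: fN; rewrite !inE neq.
have sub : [set x in A | (if x == x0 then y1 else f x) == y] \subset
   (if y == y1 then [set x0] else set0) :|: [set x in A :\ x0 | f x == y].
  apply/subsetP=> x; rewrite !inE; case: (eqVneq x x0) => [->|_] /andP[xA /eqP <-].
    by rewrite eqxx inE eqxx.
  by rewrite xA eqxx orbT.
apply: leq_trans (subset_leq_card sub) _.
apply: leq_trans (leq_card_setU _ _) _.
have := fcap y; case: (eqVneq y y1) => [->|_]; last by rewrite cards0 subn0.
by rewrite cards1 => le; rewrite add1n -(ltn_predK (n := cap y1) (m := 0)) ?lt0n // ltnS -subn1.
Qed.

(* Hall's condition, after multiplication by [g], bounds a sum of rows of [w]
   by the sum of the columns that these rows meet. *)
Lemma weighted_matching (y0 : R) (g : nat) (w : L -> R -> nat) (dem : R -> nat) :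
    0 < g -> (forall x, \sum_y w x y = g) ->
    (forall y, \sum_x w x y = g * dem y) ->
  exists f : L -> R, (forall x, 0 < w x (f x)) /\
    (forall y, #|[set x | f x == y]| = dem y).
Proof.
move=> g_gt0 rows cols.
have [B _|f [fN fcap]] :=
    @hall_capacity y0 (fun x => [pred y | 0 < w x y]) setT dem.
  rewrite -(leq_pmul2l g_gt0) big_distrr /=.
  under [X in _ <= X]eq_bigr do rewrite -cols.
  rewrite exchange_big /= mulnC -sum_nat_const.
  rewrite [X in _ <= X](bigID (mem B)) /= -[X in X <= _]addn0 leq_add //.
  apply: leq_sum => x xB; rewrite -(rows x) [X in X <= _](bigID (fun y => 0 < w x y)) /=.
  rewrite [X in _ + X <= _]big1 ?addn0 => [|y]; last by rewrite lt0n negbK => /eqP.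
  rewrite [X in _ <= X](bigID (fun y => 0 < w x y)) /=.
  rewrite -[X in X <= _]addn0 leq_add // leq_eqVlt; apply/orP; left; apply/eqP.
  apply: eq_bigl => y; case: (ltnP 0 (w x y)) => wxy; rewrite ?andbF // andbT.
  by symmetry; apply/exists_inP; exists x.
exists f; split=> [x|y]; first exact: fN.
(* The fibres and the demands have the same total, so none of the inequalities between a fibre and
   its demand can be strict. *)
have eqT : \sum_y #|[set x | f x == y]| = \sum_y dem y.
  apply/eqP; rewrite -(eqn_pmul2l g_gt0) [X in _ == X]big_distrr /=.
  under [X in _ == X]eq_bigr do rewrite -cols.
  rewrite exchange_big /=; under [X in _ == X]eq_bigr do rewrite rows.
  rewrite sum_nat_const mulnC -sum1_card (partition_big f xpredT) //=.
  by apply/eqP; congr (_ * _); apply: eq_bigr => z _; rewrite -sum1dep_card.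
have le z : #|[set x | f x == z]| <= dem z.
  by apply: leq_trans (fcap z); apply: subset_leq_card; apply/subsetP=> x; rewrite !inE.
have /leqif_sum/= : forall z, true -> #|[set x | f x == z]| <= dem z ?= iff (#|[set x | f x == z]| == dem z).
  by move=> z _; split.
by case=> _; rewrite eqT eqxx => /esym/forallP/(_ y)/eqP.
Qed.
End Matching.

(* The loads [q k] are met exactly because the [g - q k] blocks of [k] from which
   nothing is taken are matched to a dummy vertex [inr k]. *)
Lemma fair_selection (D Y K : finType) (g : nat) (y0 : Y) (A : {set D})
    (oth : D -> Y) (col : D -> K) (blk : D -> 'I_g) (q : K -> nat) (e : Y -> nat) :
    0 < g -> (forall k, q k <= g) ->
    (forall k i, #|[set d in A | (col d == k) && (blk d == i)]| = q k) ->
    (forall y, #|[set d in A | oth d == y]| = g * e y) ->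
  exists2 T : {set D}, T \subset A &
    [/\ forall k, #|[set d in T | col d == k]| = q k,
        {in T &, forall a b, col a = col b -> blk a = blk b -> a = b}
      & forall y, #|[set d in T | oth d == y]| = e y].
Proof.
move=> g_gt0 q_le blkA othA.
(* The matching has the pairs of a colour and a block on its left side. Sending such a pair to
   [inl y] means taking from it one dart with other end [y]. *)
pose S (l : K * 'I_g) y := [set d in A | [&& col d == l.1, blk d == l.2 & oth d == y]].
pose w l (r : Y + K) := match r with
  | inl y => #|S l y| | inr k => if l.1 == k then g - q k else 0 end.
pose dem r := match r with inl y => e y | inr k => g - q k end.
have [| |f [fN fdem]] := @weighted_matching _ _ (inl y0) g w dem g_gt0.
- case=> k i; rewrite big_sumType /= -big_mkcond /= (big_pred1 k) => [|k']; last by rewrite eq_sym.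
  rewrite -[RHS](subnKC (q_le k)); congr (_ + _).
  rewrite -(blkA k i) -sum1_card (partition_big oth xpredT) //=.
  apply: eq_bigr => y _; rewrite -sum1_card; apply: eq_bigl => d.
  by rewrite !inE -!andbA.
- case=> [y|k] /=.
    rewrite -othA -sum1_card (partition_big (fun d => (col d, blk d)) xpredT) //=.
    apply: eq_bigr => -[k i] _; rewrite -sum1_card; apply: eq_bigl => d.
    by rewrite !inE xpair_eqE -!andbA; case: (d \in A); rewrite //= andbA andbC.
  rewrite -(pair_bigA _ (fun k' _ => if k' == k then g - q k else 0)) /=.
  under eq_bigr do rewrite sum_nat_const card_ord.
  rewrite -big_distrr -big_mkcond /=.
  by rewrite (big_pred1 k).
pose pickS l := if f l is inl y then [pick d in S l y] else None.
pose T := [set d | pickS (col d, blk d) == Some d].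
have pickSP l d : pickS l = Some d ->
    [/\ d \in A, col d = l.1, blk d = l.2 & f l = inl (oth d)].
  rewrite /pickS; case: (f l) => // y; case: pickP => // d' + [<-].
  by rewrite !inE => /andP[dA /and3P[/eqP cd /eqP bd /eqP ->]].
have inT l d : pickS l = Some d -> d \in T /\ (col d, blk d) = l.
  move=> pd; have [_ cd bd _] := pickSP _ _ pd.
  by rewrite inE cd bd; case: l pd {cd bd} => k i /= ->; rewrite eqxx.
have pick_inl l y : f l = inl y -> exists d, pickS l = Some d.
  move=> fl; have := fN l; rewrite /pickS fl /= card_gt0 => /set0Pn[d dS].
  by case: pickP => [d'|/(_ d)]; [exists d'|rewrite dS].
have TP d : d \in T -> pickS (col d, blk d) = Some d by rewrite inE => /eqP.
exists T; first by apply/subsetP=> d /TP/pickSP[].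
split=> [k|a b /TP pa /TP pb ck bk|y].
- apply/eqP; rewrite -(eqn_add2r (g - q k)) subnKC //.
  have /= <- := fdem (inr k); rewrite -[X in _ == X]card_ord.
  (* [F] collects the blocks of colour [k] sent to the dummy vertex. There are [g - q k] of them,
     and each of the other [q k] blocks contributes exactly one dart to [T]. *)
  pose F := [set i | f (k, i) == inr k].
  have -> : #|[set l | f l == inr k]| = #|F|.
    rewrite -(card_imset F (f := fun i => (k, i))) => [|i j []//].
    apply: eq_card => -[k' i]; rewrite inE; apply/eqP/imsetP => [fl|[j]].
      have := fN (k', i); rewrite fl /=; case: eqP => // Ek _.
      by exists i; rewrite -?Ek // inE -{1}Ek fl.
    by rewrite inE => /eqP fl [-> ->].
  have -> : #|[set d in T | col d == k]| = #|~: F|.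
    have injb : {in [set d in T | col d == k] &, injective blk}.
      move=> a b; rewrite !inE => /andP[/eqP pa /eqP ca] /andP[/eqP pb /eqP cb] bk.
      by move: pa; rewrite ca bk -cb pb => -[].
    rewrite -(card_in_imset injb); apply: eq_card => i; rewrite inE.
    apply/imsetP/idP => [[d]|].
      rewrite !inE => /andP[/eqP pd /eqP <-] ->.
      by have [_ _ _ ->] := pickSP _ _ pd.
    rewrite inE; case fl: (f (k, i)) => [y|k'] => [_|].
      have [d pd] := pick_inl _ _ fl; have [dT [cd bd]] := inT _ _ pd.
      by exists d; rewrite // in_set dT cd /=.
    by have := fN (k, i); rewrite fl /=; case: eqP => // ->; rewrite eqxx.
  by rewrite addnC cardsC.
- by move: pa; rewrite ck bk pb => -[].
- have /= <- := fdem (inl y).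
  have inj : {in [set d in T | oth d == y] &, injective (fun d => (col d, blk d))}.
    move=> a b; rewrite !inE => /andP[/eqP pa _] /andP[/eqP pb _] [ca ba].
    by move: pa; rewrite ca ba pb => -[].
  rewrite -(card_in_imset inj); apply: eq_card => l; rewrite inE.
  apply/imsetP/eqP => [[d]|fl].
    by rewrite !inE => /andP[/eqP pd /eqP <-] ->; have [_ _ _ ->] := pickSP _ _ pd.
  have [d pd] := pick_inl _ _ fl; have [dT cbd] := inT _ _ pd.
  have [_ _ _] := pickSP _ _ pd; rewrite fl => -[yd].
  by exists d; rewrite // in_set dT yd /=.
Qed.

(** * Closed trails *)

(* A dart [(e, b)] is the edge [e] with an orientation. *)
Definition flip (E : Type) (d : E * bool) := (d.1, ~~ d.2).

Lemma flipK (E : Type) : involutive (@flip E).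
Proof. by case=> e b; rewrite /flip /= negbK. Qed.

Section Walks.
Variables (E X : eqType).
Implicit Types (tl : E * bool -> X) (p c : seq (E * bool)) (d : E * bool).

Lemma same_edge d d' : d.1 = d'.1 -> d = d' \/ d = flip d'.
Proof. by case: d d' => e [] [e' []] /= ->; [left|right|right|left]. Qed.

Lemma mem_edges p d : (d.1 \in unzip1 p) = (d \in p) || (flip d \in p).
Proof.
apply/mapP/orP => [[d' d'p /same_edge[->|->]]|[dp|dp]].
- by left.
- by right; rewrite flipK.
- by exists d.
- by exists (flip d).
Qed.

(** The function [tl] gives the tail of a dart; its head is the tail of the flipped dart. *)
Fixpoint walk tl (x : X) p (y : X) :=
  if p is d :: p' then (tl d == x) && walk tl (tl (flip d)) p' y else x == y.

Lemma walk_cat tl x p1 p2 y :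
  reflect (exists2 z, walk tl x p1 z & walk tl z p2 y) (walk tl x (p1 ++ p2) y).
Proof.
apply: (iffP idP); elim: p1 x => [|d p IHp] x /=.
- by exists x; rewrite /= ?eqxx.
- by case/andP=> -> /IHp[z]; exists z.
- by case=> z /eqP->.
- by case=> z /andP[-> w1] w2; apply: IHp; exists z.
Qed.

Lemma walk_flatten tl x (Bs : seq (seq (E * bool))) :
  all (fun B => walk tl x B x) Bs -> walk tl x (flatten Bs) x.
Proof.
elim: Bs => [|B Bs IHBs] /=; first by rewrite eqxx.
by case/andP=> wB /IHBs wBs; apply/walk_cat; exists x.
Qed.

Lemma walk_rev tl x p y :
  walk tl x p y -> walk tl y (rev (map (@flip E) p)) x.
Proof.
elim: p x => [|d p IHp] x /=; first by rewrite eq_sym.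
case/andP=> /eqP <- /IHp w; rewrite rev_cons -cats1; apply/walk_cat.
by exists (tl (flip d)); rewrite //= flipK !eqxx.
Qed.

Lemma unzip1_flip p : unzip1 (map (@flip E) p) = unzip1 p.
Proof. by rewrite /unzip1 -map_comp. Qed.

(** Departures and arrivals at [z] differ only through the two ends of the walk. On a closed trail
    the darts at [z] are therefore twice the departures, which is how degrees become numbers of
    visits below. *)
Lemma walk_balance tl x p y z : walk tl x p y ->
  count (fun d => tl d == z) p + (y == z) =
  count (fun d => tl (flip d) == z) p + (x == z).
Proof.
elim: p x => [|d p IHp] x /=; first by move/eqP->.
case/andP=> /eqP <- /IHp; rewrite -addnA => ->.
by rewrite addnC; congr (_ + _); rewrite addnC.
Qed.

Lemma eq_in_walk tl tl' p x y :
    (forall d, d.1 \in unzip1 p -> tl' d = tl d) ->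
  walk tl' x p y = walk tl x p y.
Proof.
elim: p x => //= d p IHp x eq_tl.
rewrite !eq_tl ?inE ?eqxx // IHp // => d' d'p.
by rewrite eq_tl // inE d'p orbT.
Qed.

Lemma walk_rot tl y c x : walk tl y c y -> has (fun d => tl d == x) c ->
  exists2 c', walk tl x c' x & perm_eq c' c.
Proof.
move=> w /hasP[d dc /eqP tld]; case/splitPr: dc w => c1 c2 /walk_cat[z w1].
case/andP=> /eqP zd w2; exists (d :: c2 ++ c1); last by rewrite -cat_cons perm_catC.
by rewrite /= tld eqxx; apply/walk_cat; exists y; rewrite // -tld zd.
Qed.

(** A single departure from [x] means that the closed walk does not return to [x] before its end. *)
Definition loop tl x B := walk tl x B x && (count (fun d => tl d == x) B == 1).

Lemma walk_loops tl x c : walk tl x c x ->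
  exists2 Bs, flatten Bs = c & all (loop tl x) Bs.
Proof.
(* The induction needs walks that start anywhere: [B0] is the part before the first visit to [x],
   and it is empty when the walk starts at [x]. *)
move=> w; suff [B0 [Bs [eq_c w0 n0 lBs]]] : exists B0 Bs,
    [/\ c = B0 ++ flatten Bs, walk tl x B0 x,
        count (fun d => tl d == x) B0 = 0 & all (loop tl x) Bs].
  exists Bs => //; case: B0 eq_c w0 n0 => [-> //|d B0 _ /=].
  by case/andP=> ->.
elim: c {1 3}x w => [|d c IHc] z /=; first by exists [::], [::].
case/andP=> tld /IHc[B0 [Bs [-> w0 n0 lBs]]].
have [zx|nzx] := eqVneq z x.
  subst z; exists [::], ((d :: B0) :: Bs); split=> //=.
  by rewrite lBs /loop /= tld n0 w0.
exists (d :: B0), Bs; split=> //=; first by rewrite tld.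
by rewrite (eqP tld) (negbTE nzx).
Qed.

Lemma size_loops tl x Bs : all (loop tl x) Bs ->
  size Bs = count (fun d => tl d == x) (flatten Bs).
Proof.
elim: Bs => //= B Bs IHBs /andP[/andP[_ /eqP nB] /IHBs->].
by rewrite count_cat nB.
Qed.

Lemma loop_rev tl x B : loop tl x B -> loop tl x (rev (map (@flip E) B)).
Proof.
case/andP=> w n; rewrite /loop walk_rev // count_rev count_map.
by have /eqP := walk_balance x w; rewrite eqn_add2r => /eqP <-.
Qed.

(** Only the first dart of a loop leaves [x], so a loop through [a] begins with [a]. If the loop
    uses the edge as [flip a], it is reversed first. *)
Lemma loop_start tl x B a : loop tl x B -> a.1 \in unzip1 B -> tl a = x ->
  exists2 p, walk tl x (a :: p) x & perm_eq (a.1 :: unzip1 p) (unzip1 B).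
Proof.
move=> lB aB tla.
have start B' : loop tl x B' -> a \in B' -> exists p, B' = a :: p.
  case/andP; case: B' => // d p /andP[/eqP tld _] /=; rewrite tld eqxx => n0.
  rewrite inE => /predU1P[->|ap]; first by exists p.
  have: has (fun d => tl d == x) p by apply/hasP; exists a; rewrite ?tla.
  by rewrite has_count; case: (count _ p) n0.
move: aB; rewrite mem_edges => /orP[/(start _ lB)[p eB]|aB].
  by exists p; rewrite eB // in lB *; case/andP: lB.
have := loop_rev lB; have aB' : a \in rev (map (@flip E) B).
  by rewrite mem_rev -(flipK a) map_f.
move=> lB'; have [p eB'] := start _ lB' aB'.
exists p; first by rewrite -eB'; case/andP: lB'.
by rewrite -[a.1 :: _]/(unzip1 (a :: p)) -eB' /unzip1 map_rev perm_rev -/(unzip1 _) unzip1_flip.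
Qed.

Lemma loop_end tl x B a : loop tl x B -> a.1 \in unzip1 B -> tl a = x ->
  exists2 p, walk tl x (rcons p (flip a)) x & perm_eq (rcons (unzip1 p) a.1) (unzip1 B).
Proof.
move=> lB aB /(loop_start lB aB)[p w pB]; exists (rev (map (@flip E) p)).
  by rewrite -rev_cons -map_cons walk_rev.
apply: perm_trans pB; rewrite perm_rcons perm_cons /unzip1 map_rev perm_rev.
by rewrite -/(unzip1 _) unzip1_flip.
Qed.

(* Detaching at [x] the darts [a] and [b] of two distinct loops leaves a closed
   trail, because a loop can be traversed in either direction. *)
Lemma loops_reroute tl x Bs Bi Bj a b :
    all (loop tl x) Bs -> Bi \in Bs -> Bj \in Bs -> Bi != Bj ->
    a.1 \in unzip1 Bi -> b.1 \in unzip1 Bj -> tl a = x -> tl b = x ->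
  exists2 p, walk tl x (b :: rcons p (flip a)) x
           & perm_eq (b.1 :: rcons (unzip1 p) a.1) (unzip1 (flatten Bs)).
Proof.
move=> lBs BiBs BjBs nij aBi bBj tla tlb.
have BjBs' : Bj \in rem Bi Bs.
  by have := perm_mem (perm_to_rem BiBs) Bj; rewrite BjBs inE eq_sym (negbTE nij).
set rest := rem Bj (rem Bi Bs).
have pBs : perm_eq Bs (Bi :: Bj :: rest).
  by apply: perm_trans (perm_to_rem BiBs) _; rewrite perm_cons perm_to_rem.
have := lBs; rewrite (perm_all _ pBs) => /and3P[lBi lBj lrest].
have [pj wj eqj] := loop_start lBj bBj tlb.
have [pi wi eqi] := loop_end lBi aBi tla.
(* The loop of [b] comes first, started by [b]; the loop of [a] comes last, ended by [flip a]; all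
   other loops run in between. *)
exists (pj ++ flatten rest ++ pi).
  rewrite -cats1 -!catA cats1 -cat_cons; apply/walk_cat; exists x => //.
  apply/walk_cat; exists x => //; apply: walk_flatten.
  by apply: sub_all lrest => B /andP[].
rewrite perm_sym (perm_trans (perm_map _ (perm_flatten pBs))) //= /unzip1 !map_cat.
rewrite -cats1 -!catA cats1 -cat_cons perm_catC -catA; apply: perm_cat.
  by rewrite perm_sym.
rewrite perm_cat2l perm_sym //.
Qed.

End Walks.

(** A trail uses each of its edges once, so the darts on these edges split into those of the trail
    and their flips. *)
Lemma card_darts (E : finType) (p : seq (E * bool)) (P : pred (E * bool)) :
    uniq (unzip1 p) ->
  #|[set d : E * bool | (d.1 \in unzip1 p) && P d]| =
  count P p + count (fun d => P (flip d)) p.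
Proof.
move=> up; have up' := map_uniq up.
rewrite -(count_map (@flip E) P) -count_cat -size_filter.
rewrite -(card_uniqP _); last first.
  apply: filter_uniq; rewrite cat_uniq up' (map_inj_uniq (can_inj (@flipK E))) up' andbT.
  apply/hasPn=> _ /mapP[d dp ->]; apply/negP.
  case/splitPr: dp up => p1 p2; rewrite /unzip1 map_cat cat_uniq /= negb_or.
  case/and4P=> _ /andP[d1 _] d2 _; rewrite mem_cat inE => /or3P[fd|/eqP fd|fd].
  - by case/negP: d1; rewrite -[d.1]/((flip d).1) map_f.
  - by case: d {d1 d2} fd => e [].
  - by case/negP: d2; rewrite -[d.1]/((flip d).1) map_f.
apply: eq_card => d; rewrite inE mem_filter mem_cat mem_edges andbC.
by rewrite -[X in _ && (_ || X)](mem_map (can_inj (@flipK E))) flipK.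
Qed.

Lemma find_flatten (T : eqType) (ss : seq (seq T)) i e :
  uniq (flatten ss) -> e \in nth [::] ss i -> find (fun s => e \in s) ss = i.
Proof.
elim: ss i => [|s ss IHss] [|i] //=; rewrite cat_uniq => /and3P[_ dis uss].
  by move->.
move=> ei; case: ifP => [es|_]; last by rewrite (IHss i).
case/hasP: dis; exists e => //; apply/flattenP; exists (nth [::] ss i) => //.
by rewrite mem_nth // ltnNge; apply/negP=> le; rewrite nth_default in ei.
Qed.

(** * Detachments *)

Section Detachment.
Variables (E K U : finType) (m lam : nat).
Notation X := (U * 'I_m)%type.
(** Here [bv d] is the tail of [d] in the graph where each part is still one vertex, [q k u] is the
    degree in colour [k] that each unit of weight at [u] carries, and [cyc] singles out the colours
    that come from cycles. *)
Variables (bv : E * bool -> U) (col : E -> K) (q : K -> U -> nat) (cyc : pred K).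
Hypothesis bv_flip : forall d, bv (flip d) != bv d.
Hypothesis q_cyc : forall k u,
  if cyc k then (q k u == 0) || (q k u == 2) else q k u <= 1.

(* A vertex [x] of weight [wt x] is an amalgam of [wt x] vertices of the final
   graph; [tl d] is the tail of the dart [d]. *)
Record detachment (wt : X -> nat) (tl : E * bool -> X) : Prop := Detachment {
  detach_part : forall d, (tl d).1 = bv d;
  detach_mult : forall x y, x.1 != y.1 ->
    #|[set d | (tl (flip d) == y) && (tl d == x)]| = lam * (wt x * wt y);
  detach_deg : forall k x,
    #|[set d : E * bool | (col d.1 == k) && (tl d == x)]| = q k x.1 * wt x;
  detach_trail : forall k, cyc k -> exists y c,
    [/\ walk tl y c y, uniq (unzip1 c) & forall e, (e \in unzip1 c) = (col e == k)]
}.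

(** The blocks from which [fair_selection] takes at most one dart each. In a cycle colour they are
    the loops of the trail at [x], each with two darts at [x], and [loops_reroute] applies to darts
    of different blocks. *)
Lemma colour_blocks wt tl x g k : detachment wt tl -> wt x = g.+1 ->
  exists blk : E * bool -> 'I_g.+1,
    (forall i, #|[set d : E * bool | [&& tl d == x, col d.1 == k & blk d == i]]| = q k x.1)
    /\ (cyc k -> forall a b, col a.1 = k -> col b.1 = k -> tl a = x -> tl b = x ->
        blk a != blk b ->
        exists p, [/\ walk tl x (b :: rcons p (flip a)) x,
                      uniq (b.1 :: rcons (unzip1 p) a.1)
                    & forall e, (e \in b.1 :: rcons (unzip1 p) a.1) = (col e == k)]).
Proof.
move=> det wtx; have := detach_deg det k x; set A := [set _ | _] => cardA.
have q0 : q k x.1 = 0 -> forall d, col d.1 = k -> tl d = x -> False.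
  move=> q0 d cd td; have := cardA; rewrite q0 mul0n => /eqP.
  by rewrite cards_eq0 => /eqP/setP/(_ d); rewrite !inE cd td !eqxx.
have [q00|qn0] := eqVneq (q k x.1) 0.
  exists (fun=> ord0); split=> [i|_ a b ca _ ta]; last by case: (q0 q00 a).
  rewrite q00; apply/eqP; rewrite cards_eq0; apply/eqP/setP=> d; rewrite !inE.
  by apply/negP=> /and3P[/eqP td /eqP cd _]; apply: (q0 q00 d).
(* Outside the cycle colours there is one dart per unit of weight; each is its own block, numbered
   by its position in [enum A]. *)
case ck: (cyc k); last first.
  have q1 : q k x.1 = 1.
    by apply/eqP; rewrite eqn_leq lt0n qn0 andbT; have := q_cyc k x.1; rewrite ck.
  rewrite q1 mul1n wtx in cardA *.
  have /card_gt0P[d0 _] : 0 < #|A| by rewrite cardA.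
  have sA : size (enum A) = g.+1 by rewrite -cardE.
  have AE d : (d \in A) = (tl d == x) && (col d.1 == k) by rewrite inE andbC.
  exists (fun d => inord (index d (enum A))); split=> // i.
  rewrite -[RHS](cards1 (nth d0 (enum A) i)); apply: eq_card => d.
  rewrite !inE andbA -AE; apply/andP/eqP => [[dA /eqP <-]|->].
    by rewrite inordK ?nth_index ?mem_enum // -sA index_mem mem_enum.
  have lt : i < size (enum A) by rewrite sA.
  by rewrite -mem_enum mem_nth // index_uniq ?enum_uniq // inord_val.
have := q_cyc k x.1; rewrite ck (negbTE qn0) /= => /eqP q2.
have [y [c [wc uc ec]]] := detach_trail det ck.
(* There are [2 * g.+1] darts of colour [k] at [x], and half of them are departures, so the trail
   falls into [g.+1] loops. *)
have nc : count (fun d => tl d == x) c = g.+1.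
  move: cardA; rewrite q2 wtx /A.
  have -> : [set d : E * bool | (col d.1 == k) && (tl d == x)] =
            [set d : E * bool | (d.1 \in unzip1 c) && (tl d == x)].
    by apply/setP=> d; rewrite !inE ec.
  rewrite card_darts //; have /eqP := walk_balance x wc; rewrite eqn_add2r => /eqP <-.
  by rewrite addnn -mul2n => /eqP; rewrite eqn_pmul2l // => /eqP.
have [|c' wc' pc'] := @walk_rot _ _ tl y c x wc; first by rewrite has_count nc.
have [Bs eBs lBs] := walk_loops wc'.
have sBs : size Bs = g.+1 by rewrite (size_loops lBs) eBs (permP pc').
have pBs : perm_eq (unzip1 (flatten Bs)) (unzip1 c) by rewrite eBs perm_map.
have fBs : unzip1 (flatten Bs) = flatten (map unzip1 Bs) by rewrite /unzip1 map_flatten.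
have uBs : uniq (flatten (map unzip1 Bs)) by rewrite -fBs (perm_uniq pBs).
(* The block of a dart is the position of the loop that contains its edge. *)
pose fnd (d : E * bool) := find (fun s => d.1 \in s) (map unzip1 Bs).
have fndP (d : E * bool) : col d.1 = k -> fnd d < g.+1 /\ d.1 \in unzip1 (nth [::] Bs (fnd d)).
  move=> cd; have: d.1 \in flatten (map unzip1 Bs).
    by rewrite -fBs (perm_mem pBs) ec cd.
  move/flattenP=> hs; have {}hs : has (fun s => d.1 \in s) (map unzip1 Bs).
    by apply/hasP; case: hs => s; exists s.
  have := hs; rewrite has_find size_map sBs => lt; split=> //.
  by have := nth_find [::] hs; rewrite -/(fnd d) (nth_map [::]) // sBs.
have fndE (d : E * bool) i : i < g.+1 -> d.1 \in unzip1 (nth [::] Bs i) -> fnd d = i.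
  by move=> lt di; apply: find_flatten; rewrite // (nth_map [::]) ?sBs.
have nthBs i : i < g.+1 -> nth [::] Bs i \in Bs by move=> lt; rewrite mem_nth ?sBs.
exists (fun d => inord (fnd d)); split=> [i|_ a b ca cb ta tb nab].
  set B := nth [::] Bs i; have BBs : B \in Bs by rewrite nthBs.
  have /andP[wB nB] := allP lBs B BBs.
  transitivity #|[set d : E * bool | (d.1 \in unzip1 B) && (tl d == x)]|.
    apply: eq_card => d; rewrite !inE; apply/and3P/andP => [[td /eqP cd /eqP fi]|[dB td]].
      by have [lt dB] := fndP d cd; rewrite /B -fi inordK.
    have cd : col d.1 == k.
      rewrite -ec -(perm_mem pBs) fBs; apply/flattenP; exists (unzip1 B) => //.
      by rewrite map_f.
    by rewrite td cd (fndE d i) // inord_val.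
  have uB : uniq (unzip1 B).
    have := perm_flatten (perm_map unzip1 (perm_to_rem BBs)).
    by move/perm_uniq; rewrite uBs /= cat_uniq => /esym/andP[].
  rewrite card_darts //; have /eqP := walk_balance x wB.
  by rewrite eqn_add2r => /eqP <-; rewrite (eqP nB) q2.
have [la aB] := fndP a ca; have [lb bB] := fndP b cb.
have [|p wp pp] := loops_reroute lBs (nthBs _ la) (nthBs _ lb) _ aB bB ta tb.
  by apply: contra nab => /eqP eB; rewrite (fndE a (fnd b)) // -eB.
have pp' := perm_trans pp pBs.
exists p; split=> // [|e]; first by have := perm_uniq pp'; rewrite uc.
by have := perm_mem pp' e; rewrite ec.
Qed.

Section Step.
Variables (wt : X -> nat) (tl : E * bool -> X) (x x' : X).
Hypotheses (det : detachment wt tl) (wtx : 1 < wt x) (wtx' : wt x' = 0)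
  (xx' : x'.1 = x.1).

Lemma detach_step : exists tl',
  detachment (fun z => if z == x then (wt x).-1 else if z == x' then 1 else wt z) tl'.
Proof.
have neq : x' != x by apply: contraTneq wtx => <-; rewrite wtx'.
have [g wtg] : exists g, wt x = g.+2 by case: (wt x) wtx => [|[|g]] // _; exists g.
rewrite wtg.
have [blk blkP] := fin_all_exists (fun k => colour_blocks k det wtg).
(* The demand is the fraction [1 / wt x] of the [lam * (wt x * wt y)] darts from [x] to [y], hence
   [lam * wt y]. It is zero inside the part of [x], where [bv_flip] excludes edges. *)
have := @fair_selection _ X K g.+2 x [set d | tl d == x] (fun d => tl (flip d))
  (fun d => col d.1) (fun d => blk (col d.1) d) (fun k => q k x.1)
  (fun y => if y.1 == x.1 then 0 else lam * wt y).
case=> [//|k|k i|y|T sTA [Tcol Tblk Toth]].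
- by have := q_cyc k x.1; case: (cyc k) => [/pred2P[] ->|/leq_trans->].
- rewrite -[RHS](proj1 (blkP k) i); apply: eq_card => d; rewrite !inE.
  by case: eqP => // _; case: eqP => // ->.
- case: eqP => [yx|/eqP yx].
    rewrite muln0; apply/eqP; rewrite cards_eq0; apply/eqP/setP=> d; rewrite !inE.
    apply/negP=> /andP[/eqP tx /eqP ty]; case/negP: (bv_flip d).
    by rewrite -!(detach_part det) ty tx yx.
  rewrite mulnCA -wtg -(detach_mult det) 1?eq_sym //.
  by apply: eq_card => d; rewrite !inE andbC.
have Tx d : d \in T -> tl d = x by move/(subsetP sTA); rewrite inE => /eqP.
(* No edge has both its darts selected, so at most one end of each edge moves to [x']. *)
have Tflip d : tl d = x -> flip d \notin T.
  move=> td; apply/negP=> /Tx tfd; case/negP: (bv_flip d).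
  by rewrite -!(detach_part det) td tfd.
have nox' d : tl d != x'.
  apply/eqP=> td; have := detach_deg det (col d.1) x'; rewrite wtx' muln0 => /eqP.
  by rewrite cards_eq0 => /eqP/setP/(_ d); rewrite !inE td !eqxx.
pose tl' d := if d \in T then x' else tl d.
have outT z d : z.1 != x.1 -> (tl' d == z) = (tl d == z).
  rewrite /tl'; case: ifP => // /Tx -> zx.
  by apply/eqP/eqP => ez; move: zx; rewrite -ez ?xx' eqxx.
(* This and the next two counts reduce every degree and multiplicity after the move to old values
   and to the size of the selection: at [x], at [x'] and at any other vertex. *)
have cntx (P : pred (E * bool)) : #|[set d | P d && (tl' d == x)]| +
    #|[set d in T | P d]| = #|[set d | P d && (tl d == x)]|.
  rewrite -(cardsID T [set d | P d && (tl d == x)]) addnC; congr (_ + _).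
    apply: eq_card => d; rewrite !inE andbC; case dT: (d \in T); rewrite ?andbF //.
    by rewrite Tx // eqxx !andbT.
  apply: eq_card => d; rewrite !inE /tl'; case: ifP => //=; by rewrite (negbTE neq) andbF.
have cntx' (P : pred (E * bool)) :
    #|[set d | P d && (tl' d == x')]| = #|[set d in T | P d]|.
  apply: eq_card => d; rewrite !inE /tl'; case: ifP => _; first by rewrite eqxx andbT.
  by rewrite (negbTE (nox' d)) andbF.
have cntz (P : pred (E * bool)) z : z != x -> z != x' ->
    #|[set d | P d && (tl' d == z)]| = #|[set d | P d && (tl d == z)]|.
  move=> zx zx'; apply: eq_card => d; rewrite !inE /tl'; case: ifP => // /Tx ->.
  by rewrite ![_ == z]eq_sym (negbTE zx) (negbTE zx').
exists tl'; set wt' := fun z => _; split.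
- by move=> d; rewrite /tl' -(detach_part det); case: ifP => // /Tx ->.
- have wt'E v : v.1 != x.1 -> wt' v = wt v.
    rewrite /wt'; case: (eqVneq v x) => [->|_]; [|case: (eqVneq v x') => [->|_]];
      by rewrite ?xx' ?eqxx.
  have multx z y : z.1 = x.1 -> y.1 != x.1 ->
      #|[set d | (tl' (flip d) == y) && (tl' d == z)]| = lam * (wt' z * wt' y).
    move=> zx yx; have wty := wt'E y yx.
    have -> : [set d | (tl' (flip d) == y) && (tl' d == z)] =
              [set d | (tl (flip d) == y) && (tl' d == z)].
      by apply/setP=> d; rewrite !inE outT.
    have := Toth y; rewrite (negbTE yx) => oy; rewrite wty /wt'.
    have [->|nzx] := eqVneq z x.
      have := cntx (fun d => tl (flip d) == y); rewrite oy (detach_mult det) 1?eq_sym //.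
      rewrite wtg [in RHS]mulSn mulnDr addnC => /eqP; rewrite eqn_add2l => /eqP->.
      by [].
    have [->|nzx'] := eqVneq z x'; first by rewrite cntx' oy mul1n.
    by rewrite cntz // (detach_mult det) // zx eq_sym.
  move=> z y zy; have [zx|nzx] := eqVneq z.1 x.1.
    by rewrite multx // -zx eq_sym.
  have [yx|nyx] := eqVneq y.1 x.1.
    rewrite (mulnC (wt' z)) -multx // -(card_imset _ (can_inj (@flipK E))).
    apply: eq_card => d; rewrite inE; apply/imsetP/idP => [[d' + ->]|].
      by rewrite inE flipK andbC.
    by exists (flip d); rewrite ?flipK // inE flipK andbC.
  have -> : [set d | (tl' (flip d) == y) && (tl' d == z)] =
            [set d | (tl (flip d) == y) && (tl d == z)].
    by apply/setP=> d; rewrite !inE !outT.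
  by rewrite !wt'E // (detach_mult det).
- move=> k z; rewrite /wt'.
  have [->|nzx] := eqVneq z x.
    have := cntx (fun d => col d.1 == k); rewrite Tcol (detach_deg det) wtg.
    by rewrite mulnS addnC => /eqP; rewrite eqn_add2l => /eqP->.
  have [->|nzx'] := eqVneq z x'; first by rewrite cntx' Tcol muln1 xx'.
  by rewrite cntz // (detach_deg det).
(* With [q k x.1 = 0] no dart of colour [k] moves and the old trail stays. With the value 2, exactly
   two darts [a] and [b] move, and [Tblk] puts them into different loops. *)
- move=> k ck; have := q_cyc k x.1; rewrite ck => /pred2P[] qk.
    have [y [c [wc uc ec]]] := detach_trail det ck; exists y, c; split=> //.
    rewrite (@eq_in_walk _ _ tl) // => d; rewrite ec /tl' => /eqP cd.
    case: ifP => // dT; have := Tcol k; rewrite qk => /eqP.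
    by rewrite cards_eq0 => /eqP/setP/(_ d); rewrite !inE dT cd eqxx.
  have /eqP/cards2P[a [b [nab Tab]]] := etrans (Tcol k) qk.
  have inTk d : d \in T -> col d.1 = k -> d = a \/ d = b.
    move=> dT cd; have : d \in [set d in T | col d.1 == k] by rewrite inE dT cd eqxx.
    by rewrite Tab => /set2P.
  have : a \in [set a; b] by rewrite !inE eqxx.
  rewrite -Tab inE => /andP[aT /eqP ca].
  have : b \in [set a; b] by rewrite !inE eqxx orbT.
  rewrite -Tab inE => /andP[bT /eqP cb].
  have [|p [wp up ep]] := proj2 (blkP k) ck a b ca cb (Tx _ aT) (Tx _ bT).
    apply: contra nab => /eqP ab; apply/eqP; apply: Tblk; rewrite ?ca ?cb //.
  (* In the rerouted trail only the first tail and the last head pass from [x] to [x'], so it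
     becomes a closed trail at [x']. *)
  exists x', (b :: rcons p (flip a)).
  have eup : unzip1 (b :: rcons p (flip a)) = b.1 :: rcons (unzip1 p) a.1.
    by rewrite /= /unzip1 map_rcons.
  split; rewrite ?eup //.
  move: wp; rewrite /= [tl' b]/tl' bT eqxx => /andP[_].
  rewrite /tl' (negbTE (Tflip b (Tx _ bT))) -/tl' -!cats1 => /walk_cat[z wz].
  rewrite /= => /andP[az _]; apply/walk_cat; exists z.
    rewrite (@eq_in_walk _ _ tl) // => d dp; rewrite /tl'; case: ifP => // dT.
    have cd : col d.1 = k.
      by apply/eqP; rewrite -ep inE mem_rcons inE dp !orbT.
    move: up; rewrite /= rcons_uniq mem_rcons inE negb_or => /and3P[/andP[_ nb] na _].
    by case: (inTk d dT cd) dp => ->; rewrite ?(negbTE na) ?(negbTE nb).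
  by rewrite /= /tl' (negbTE (Tflip a (Tx _ aT))) flipK aT az eqxx.
Qed.
End Step.

(** Induction on the number of vertices of weight 0. A part has [m] vertices and total weight [m],
    so a weight above 1 forces a weight 0 in the same part, to be used as [x']; if no weight exceeds
    1, all are equal to 1. *)
Lemma detach_all wt tl : detachment wt tl ->
  (forall u, \sum_(a < m) wt (u, a) = m) ->
  exists tl', detachment (fun=> 1) tl'.
Proof.
have [N] := ubnP #|[set x | wt x == 0]|; elim: N => // N IHN in wt tl *.
move=> leN det sumwt.
have [/forallP n1|] := boolP [forall x, wt x <= 1].
  exists tl; suff wt1 x : wt x = 1.
    by case: det => h1 h2 h3 h4; split=> // [x y xy|k x]; rewrite ?h2 ?h3 ?wt1.
  case: x => u a; have/leqif_sum/= : forall b, true -> wt (u, b) <= 1 ?= iff (wt (u, b) == 1).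
    by move=> b _; split.
  by rewrite sumwt sum1_card card_ord => -[_]; rewrite eqxx => /esym/forallP/(_ a)/eqP.
rewrite negb_forall => /existsP[[u a]]; rewrite -ltnNge => wtx.
have [a' wta'] : exists a', wt (u, a') = 0.
  have [/existsP[a' /eqP wa]|] := boolP [exists a', wt (u, a') == 0]; first by exists a'.
  rewrite negb_exists => /forallP pos.
  have : m < \sum_(b < m) wt (u, b).
    rewrite -[X in X < _]card_ord -sum1_card (bigD1 a) //= [X in _ < X](bigD1 a) //= -addSn leq_add //.
    by apply: leq_sum => b _; rewrite lt0n.
  by rewrite sumwt ltnn.
have [tl' det'] := detach_step det wtx wta' erefl.
have neq : a' != a by apply: contraTneq wtx => <-; rewrite wta'.
apply: IHN det' _ => [|u0].
  rewrite -ltnS; apply: leq_trans _ leN; rewrite ltnS; apply: proper_card.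
  apply/properP; split; last first.
    by exists (u, a'); rewrite !inE ?wta' // xpair_eqE (negbTE neq) andbF eqxx.
  apply/subsetP=> z; rewrite !inE; case: (eqVneq z (u, a)) => [->|_]; last by case: ifP.
  by case: (wt _) wtx => [|[]].
have [->|nu] := eqVneq u0 u; last first.
  rewrite -[RHS](sumwt u0); apply: eq_bigr => b _.
  by rewrite !xpair_eqE (negbTE nu).
rewrite -[RHS](sumwt u) (bigD1 a) // (bigD1 a') //= [RHS](bigD1 a) // (bigD1 a') //=.
rewrite !xpair_eqE !eqxx (negbTE neq) /= wta' add0n addnA addn1 prednK ?(ltnW wtx) //.
congr (_ + _); apply: eq_bigr => b /andP[nba nba'].
by rewrite !xpair_eqE (negbTE nba) (negbTE nba') !andbF.
Qed.
End Detachment.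

(** * Cycles as closed walks; choice and counting *)

Lemma walk_cycle (E X : eqType) (tl : E * bool -> X) d p :
  walk tl (tl d) (d :: p) (tl d) = cycle (fun d1 d2 => tl (flip d1) == tl d2) (d :: p).
Proof.
rewrite /cycle; move: {3 5}d => d'; elim: p d => [|d1 p IHp] d.
  by rewrite /= eqxx andbT.
rewrite rcons_cons [RHS]/= -IHp /= !eqxx /= eq_sym.
by case: eqP.
Qed.

Lemma in_choice (A : eqType) (B : Type) (R : A -> B -> Prop) (b0 : B) (s : seq A) :
  (forall x, x \in s -> exists y, R x y) -> exists f, forall x, x \in s -> R x (f x).
Proof.
elim: s => [|x s IHs] ex; first by exists (fun=> b0).
have [|f fR] := IHs; first by move=> z zs; apply: ex; rewrite inE zs orbT.
have [y xy] := ex x (mem_head _ _).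
exists (fun z => if z == x then y else f z) => z; rewrite inE.
by case: eqP => [-> //|_] /= /fR.
Qed.

Lemma count1_inj (A : eqType) (P : pred A) (s : seq A) x y :
  count P s = 1 -> x \in s -> y \in s -> P x -> P y -> x = y.
Proof.
move=> c1 xs ys Px Py; apply/eqP/negPn/negP=> xy.
have := permP (perm_to_rem xs) P; rewrite c1 /= Px => -[] /esym/eqP.
rewrite -leqn0 leqNgt -has_count => /hasPn/(_ y); rewrite Py.
have := perm_mem (perm_to_rem xs) y; rewrite ys inE eq_sym (negbTE xy) /= => <-.
by move/(_ isT).
Qed.

Lemma uniq_flatten_inj (B C : eqType) (f : B -> seq C) ss s s' x :
  uniq (flatten (map f ss)) -> s \in ss -> s' \in ss -> x \in f s -> x \in f s' -> s = s'.
Proof.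
move=> + sss s'ss xs xs'; rewrite (perm_uniq (perm_flatten (perm_map f (perm_to_rem sss)))).
rewrite /= cat_uniq => /and3P[_ dis _]; apply/eqP/negPn/negP=> ss'.
have := perm_mem (perm_to_rem sss) s'; rewrite s'ss inE eq_sym (negbTE ss') /= => s'r.
by case/hasP: dis; exists x => //; apply/flattenP; exists (f s'); rewrite ?map_f.
Qed.

Lemma card_dart_copies (E : finType) m (P : pred (E * bool)) :
  #|[set d : (E * 'I_m) * bool | P (d.1.1, d.2)]| = m * #|[set d | P d]|.
Proof.
pose f (z : (E * bool) * 'I_m) := ((z.1.1, z.2), z.1.2).
have fI : injective f by move=> [[e b] i] [[e' b'] i'] [-> -> ->].
rewrite mulnC -[m in RHS]card_ord -cardsT -cardsX -(card_imset _ fI).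
apply: eq_card => -[[e i] b]; rewrite inE /=; apply/idP/imsetP => [Pd|].
  by exists ((e, b), i); rewrite ?inE ?Pd.
by case=> -[[e' b'] i']; rewrite !inE => /andP[/= Pd _] [-> _ ->].
Qed.

(** * Darts and edges of multigraphs *)

Section Darts.
Variables (V E : finType) (tl : E * bool -> V).
Hypothesis tl_flip : forall e, tl (e, false) != tl (e, true).

Let pair e := [set tl (e, false); tl (e, true)].

Lemma tl_flip_neq d : tl (flip d) != tl d.
Proof. by case: d => e []; rewrite /flip /= ?(eq_sym (tl (e, true))). Qed.

Lemma pair_dart d : pair d.1 = [set tl d; tl (flip d)].
Proof. by case: d => e []; rewrite /pair //= setUC. Qed.

(** An edge has two distinct ends, so exactly one of the two darts of an edge at [x] leaves [x]. *)
Lemma card_darts_at (F : {set E}) x :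
  #|[set e in F | x \in pair e]| = #|[set d : E * bool | (d.1 \in F) && (tl d == x)]|.
Proof.
rewrite -(card_in_imset (f := fst) (D := mem [set d : E * bool | _])); last first.
  move=> d d'; rewrite !inE => /andP[_ /eqP td] /andP[_ /eqP td'] /same_edge[] // dd'.
  by have := tl_flip_neq d'; rewrite -dd' td td' eqxx.
apply: eq_card => e; rewrite !inE; apply/andP/imsetP => [[eF /orP[]/eqP xe]|].
- by exists (e, false); rewrite // inE eF xe eqxx.
- by exists (e, true); rewrite // inE eF xe eqxx.
case=> -[e' b]; rewrite inE => /andP[/= e'F /eqP <-] ->; split=> //.
by case: b; rewrite eqxx ?orbT.
Qed.

Lemma card_darts_between x y : x != y ->
  #|[set d | (tl (flip d) == y) && (tl d == x)]| = #|[set e | pair e == [set x; y]]|.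
Proof.
move=> xy; rewrite -(card_in_imset (f := fst) (D := mem [set d : E * bool | _])); last first.
  move=> d d'; rewrite !inE => /andP[_ /eqP td] /andP[/eqP td' _] /same_edge[] // dd'.
  by case/eqP: xy; rewrite -td -td' dd'.
apply: eq_card => e; rewrite inE; apply/imsetP/eqP => [[d]|].
  by rewrite inE => /andP[/eqP <- /eqP <-] ->; rewrite pair_dart.
move=> pe; have xe : x \in pair e by rewrite pe !inE eqxx.
have [d de tdx] : exists2 d : E * bool, d.1 = e & tl d = x.
  by move: xe; rewrite !inE => /orP[]/eqP->; [exists (e, false) | exists (e, true)].
exists d; rewrite // inE tdx eqxx andbT.
have : tl (flip d) \in [set x; y] by rewrite -pe -de pair_dart !inE eqxx orbT.
by rewrite !inE -tdx (negbTE (tl_flip_neq d)).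
Qed.

End Darts.

(** The edges of [E] with the same ends are numbered by their positions in [cls]; this number is the
    index in ['I_lam] of the corresponding edge of the [lambda_fold] multigraph. *)
Lemma lambda_fold_edges (lam : nat) (V E : finType) (adj : rel V) (tl : E * bool -> V) :
    irreflexive adj -> (forall e, adj (tl (e, false)) (tl (e, true))) ->
    (forall x y, adj x y -> #|[set d | (tl (flip d) == y) && (tl d == x)]| = lam) ->
  exists2 psi : E -> edge (lambda_fold lam adj), bijective psi
    & forall e, ends (psi e) = [set tl (e, false); tl (e, true)].
Proof.
move=> adj_irr adj_tl mult; set pair := fun e => [set tl (e, false); tl (e, true)].
have adj_neq x y : adj x y -> x != y by apply: contraTneq => ->; rewrite adj_irr.
have tl_flip e : tl (e, false) != tl (e, true) by apply: adj_neq.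
pose cls A := enum [set e | pair e == A].
have size_cls x y : adj x y -> size (cls [set x; y]) = lam.
  by move=> xy; rewrite /cls -cardE -(card_darts_between tl_flip) ?mult ?adj_neq.
have mem_cls e : e \in cls (pair e) by rewrite mem_enum inE.
have ex e : exists f : fold_edge lam adj, val f.1 = pair e /\ f.2 = index e (cls (pair e)) :> nat.
  have padj : adj_pair adj (pair e).
    apply/existsP; exists (tl (e, false)); apply/existsP; exists (tl (e, true)).
    by rewrite tl_flip adj_tl eqxx.
  have lt : index e (cls (pair e)) < lam.
    by rewrite -(size_cls _ _ (adj_tl e)) index_mem mem_cls.
  by exists (Sub (pair e) padj, Ordinal lt).
have [psi psiP] := fin_all_exists ex.
exists psi => [|e]; last exact: (proj1 (psiP e)).
have inj : injective psi.
  move=> e e' ee'; have [p i] := psiP e; have [p' i'] := psiP e'.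
  rewrite -ee' p in p'; rewrite -ee' i in i'.
  by rewrite -(nth_index e (mem_cls e)) i' p' nth_index.
have sur (f : fold_edge lam adj) : exists e, psi e = f.
  have /existsP[x /existsP[y /and3P[_ xy /eqP fxy]]] := valP f.1.
  have lt : f.2 < size (cls (val f.1)) by rewrite /= fxy size_cls // ltn_ord.
  have [e0 _] : exists e0 : E, True.
    by case: (cls (val f.1)) lt => // e0 _ _; exists e0.
  pose e := nth e0 (cls (val f.1)) f.2.
  have pe : pair e = val f.1.
    by apply/eqP; have := mem_nth e0 lt; rewrite mem_enum inE.
  exists e; have [p i] := psiP e; rewrite [LHS]surjective_pairing [RHS]surjective_pairing.
  congr (_, _); apply: val_inj => /=; first by rewrite p pe.
  by rewrite i pe /e index_uniq // enum_uniq.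
have [g psiK] := fin_all_exists sur.
by exists g => // e; apply: inj; rewrite psiK.
Qed.

(** * Lifting a 2-factorization *)

Section Cycles.
Variable G : multigraph.
Implicit Type c : seq (vertex G * edge G).

Lemma cycle_ends c p : is_cycle c -> p \in c ->
  exists2 q, q \in c & ends p.2 = [set p.1; q.1].
Proof.
case/and4P=> _ _ _ cyc pc; exists (next c p); first by rewrite mem_next.
by apply/eqP; apply: (next_cycle cyc pc).
Qed.

Lemma cycle_ends_sub c e v : is_cycle c -> e \in unzip2 c -> v \in ends e -> v \in unzip1 c.
Proof.
move=> cyc /mapP[p pc ->]; have [q qc ->] := cycle_ends cyc pc.
by rewrite !inE => /orP[]/eqP->; rewrite map_f.
Qed.

Variable en : edge G * bool -> vertex G.
Hypothesis endsE : forall e, ends e = [set en (e, false); en (e, true)].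

Lemma en_neq e : en (e, false) != en (e, true).
Proof. by have := card_ends e; rewrite endsE cards2 eqSS eqb1. Qed.

(** Each edge is oriented so that its tail is the vertex listed with it; its head is then the next
    vertex of the cycle. *)
Lemma cycle_trail c : is_cycle c -> exists y (c0 : seq (edge G * bool)),
  [/\ walk en y c0 y, unzip1 c0 = unzip2 c & map en c0 = unzip1 c].
Proof.
move=> cycc; have /and4P[c_gt1 _ _ rc] := cycc.
pose f (p : vertex G * edge G) := (p.2, en (p.2, true) == p.1).
have enf p : p \in c -> en (f p) = p.1.
  move=> pc; have [q _ pq] := cycle_ends cycc pc.
  have : p.1 \in ends p.2 by rewrite pq !inE eqxx.
  rewrite endsE !inE /f => /orP[/eqP E1|/eqP E1]; rewrite E1 ?eqxx //.
  by rewrite eq_sym (negbTE (en_neq _)).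
have : cycle (fun d1 d2 => en (flip d1) == en d2) (map f c).
  rewrite cycle_map; apply: (sub_in_cycle (P := mem c)) rc; last by apply/allP.
  move=> p q pc qc /eqP pq /=; rewrite (enf q) //.
  have : en (flip (f p)) \in ends p.2.
    by rewrite -[p.2]/((f p).1) endsE; case: (f p) => e []; rewrite !inE eqxx ?orbT.
  by rewrite pq !inE -(enf p) // (negbTE (tl_flip_neq en_neq _)).
case: c c_gt1 enf {rc cycc} => // p c _ enf wc.
exists (en (f p)), (map f (p :: c)); split.
- by rewrite map_cons walk_cycle -map_cons.
- by rewrite /unzip1 -map_comp.
- by rewrite -map_comp; apply/eq_in_map=> d; apply: enf.
Qed.
End Cycles.

Lemma ex_ends (G : multigraph) : exists en : edge G * bool -> vertex G,
  forall e, ends e = [set en (e, false); en (e, true)].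
Proof.
have ex (e : edge G) : exists f : bool -> vertex G, ends e = [set f false; f true].
  have /cards2P[u [v [_ ->]]] := card_ends e.
  by exists (fun b => if b then v else u).
by have [f fE] := fin_all_exists ex; exists (fun d => f d.1 d.2).
Qed.

Lemma degree_darts (G : multigraph) (E : finType) (psi : E -> edge G)
    (tl : E * bool -> vertex G) (F : {set edge G}) x :
    bijective psi -> (forall e, ends (psi e) = [set tl (e, false); tl (e, true)]) ->
  degree_in F x = #|[set d : E * bool | (psi d.1 \in F) && (tl d == x)]|.
Proof.
move=> bij_psi endsE; have tl_flip e : tl (e, false) != tl (e, true).
  by have := card_ends (psi e); rewrite endsE cards2 eqSS eqb1.
transitivity #|[set e in psi @^-1: F | x \in [set tl (e, false); tl (e, true)]]|.
  rewrite -(card_imset _ (bij_inj bij_psi)); apply: eq_card => e'.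
  have [g psiK gK] := bij_psi; rewrite inE; apply/idP/imsetP => [e'F|[e]].
    by exists (g e'); rewrite ?gK // !inE -in_set2 -endsE gK.
  by rewrite 2!inE -endsE => eF ->.
rewrite (card_darts_at tl_flip); apply: eq_card => d; by rewrite !inE.
Qed.

Section Blowup.
Variables (G : multigraph) (lam m r : nat) (T : seq nat) (Fs : seq {set edge G}).
Variable cs : {set edge G} -> seq (seq (vertex G * edge G)).
Hypothesis m_gt0 : 0 < m.
Hypothesis multG : forall u v : vertex G, u != v ->
  #|[set e : edge G | ends e == [set u; v]]| = lam * m.
Hypothesis FsP : two_factorization r Fs.
Hypothesis csP : forall F, F \in Fs ->
  [/\ all (@is_cycle G) (cs F), perm_eq [seq size c | c <- cs F] T,
      uniq (unzip1 (flatten (cs F))), forall v, v \in unzip1 (flatten (cs F))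
    & F = [set e in unzip2 (flatten (cs F))]].

Notation H := (lambda_fold lam (fun x y : vertex G * 'I_m => x.1 != y.1)).

(** Colours are edge sets: each cycle of each 2-factor is a colour of its own, named by its set of
    edges. *)
Definition edge_class (c : seq (vertex G * edge G)) := [set e in unzip2 c].
Definition cycle_class (k : {set edge G}) :=
  k \in flatten [seq [seq edge_class c | c <- cs F] | F <- Fs].
(* The edges outside all 2-factors get the colour [set0], which is the class of
   no cycle. *)
Definition colour (e : edge G) := odflt set0 [pick k | cycle_class k && (e \in k)].

Lemma cycle_classP k :
  reflect (exists F c, [/\ F \in Fs, c \in cs F, is_cycle c & k = edge_class c]) (cycle_class k).
Proof.
apply: (iffP flattenP) => [[_ /mapP[F FFs ->] /mapP[c cF ->]]|[F [c [FFs cF _ ->]]]].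
  by exists F, c; split=> //; have [/allP/(_ c cF)] := csP FFs.
by exists [seq edge_class c | c <- cs F]; apply/mapP; [exists F | exists c].
Qed.

Lemma mem_factor F c e : F \in Fs -> c \in cs F -> e \in edge_class c -> e \in F.
Proof.
move=> FFs cF; have [_ _ _ _ ->] := csP FFs; rewrite !inE /unzip2 map_flatten => ec.
by apply/flattenP; exists (unzip2 c); rewrite ?map_f.
Qed.

Lemma factor_mem F e : F \in Fs -> e \in F -> exists2 c, c \in cs F & e \in edge_class c.
Proof.
move=> FFs; have [_ _ _ _ {1}->] := csP FFs; rewrite inE /unzip2 map_flatten.
by case/flattenP=> _ /mapP[c cF ->] ec; exists c; rewrite // inE.
Qed.

Lemma factor_inj F F' e : F \in Fs -> F' \in Fs -> e \in F -> e \in F' -> F = F'.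
Proof.
move=> FFs F'Fs eF eF'; have [_ _] := FsP; case: ifP => _ => [[I _ dec]|dec]; last first.
  exact: (count1_inj (dec e)).
by apply: (count1_inj (dec e)); rewrite ?inE ?FFs ?F'Fs ?orbT.
Qed.

(** An edge lies in only one 2-factor, and two different cycles of a 2-factor share no vertex, hence
    no end of that edge. *)
Lemma edge_class_inj F F' c c' e : F \in Fs -> F' \in Fs -> c \in cs F -> c' \in cs F' ->
  e \in edge_class c -> e \in edge_class c' -> c = c'.
Proof.
move=> FFs F'Fs cF c'F' ec ec'.
have eqF : F = F' := factor_inj FFs F'Fs (mem_factor FFs cF ec) (mem_factor F'Fs c'F' ec').
rewrite -eqF in c'F' => {eqF F'Fs F'}; rewrite !inE in ec ec'.
have [/allP cyc _ uF _ _] := csP FFs.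
have /card_gt0P[v ve] : 0 < #|ends e| by rewrite (eqP (card_ends e)).
rewrite /unzip1 map_flatten in uF; apply: (uniq_flatten_inj (x := v) uF cF c'F').
  exact: cycle_ends_sub (cyc _ cF) ec ve.
exact: cycle_ends_sub (cyc _ c'F') ec' ve.
Qed.

Lemma colourP F c e : F \in Fs -> c \in cs F ->
  (e \in edge_class c) = (colour e == edge_class c).
Proof.
move=> FFs cF; have [/allP/(_ c cF) cyc _ _ _ _] := csP FFs.
rewrite /colour; case: pickP => [k /andP[/cycle_classP[F' [c' [F'Fs c'F' _ ->]]] ec']|nok] /=.
  apply/idP/eqP => [ec|<- //].
  by rewrite (edge_class_inj FFs F'Fs cF c'F' ec ec').
have := nok (edge_class c); have -> : cycle_class (edge_class c).
  by apply/cycle_classP; exists F, c.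
move=> /= ->; apply/esym/eqP => /setP; case/and4P: cyc; case: c {cF} => // p c _ _ _ _.
by move/(_ p.2); rewrite !inE eqxx.
Qed.

Lemma colour_factor F e : F \in Fs ->
  (e \in F) = (colour e \in [seq edge_class c | c <- cs F]).
Proof.
move=> FFs; apply/idP/mapP => [/(factor_mem FFs)[c cF ec]|[c cF /eqP]].
  by exists c => //; apply/eqP; rewrite -(colourP _ FFs).
by rewrite -(colourP _ FFs) //; apply: mem_factor.
Qed.

Lemma colour0 e : (colour e == set0) = ~~ has (fun F : {set edge G} => e \in F) Fs.
Proof.
apply/eqP/hasPn => [c0 F FFs|noF].
  apply/negP => /(factor_mem FFs)[c cF ec]; have := ec.
  rewrite (colourP _ FFs) // => /eqP ec'; by rewrite -ec' c0 inE in ec.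
rewrite /colour; case: pickP => // k /andP[/cycle_classP[F [c [FFs cF _ ->]]] ec].
by have := noF F FFs; rewrite (mem_factor FFs cF ec).
Qed.

Lemma colour_one_factor I e : decomposition (I :: Fs) -> (e \in I) = (colour e == set0).
Proof.
move/(_ e) => /=; rewrite colour0 has_count.
by case: (e \in I); [rewrite add1n => -[->] | rewrite add0n => ->].
Qed.

Variable en : edge G * bool -> vertex G.
Hypothesis endsE : forall e, ends e = [set en (e, false); en (e, true)].

Definition colour_degree k u :=
  #|[set d : edge G * bool | (colour d.1 == k) && (en d == u)]|.

Lemma cycle_degree F c u : F \in Fs -> c \in cs F ->
  colour_degree (edge_class c) u = 2 * count_mem u (unzip1 c).
Proof.
move=> FFs cF; have [/allP/(_ c cF) cyc _ _ _ _] := csP FFs.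
have [y [c0 [wc0 e1 e2]]] := cycle_trail endsE cyc.
have uc : uniq (unzip1 c0) by rewrite e1; case/and4P: cyc.
transitivity #|[set d : edge G * bool | (d.1 \in unzip1 c0) && (en d == u)]|.
  by apply: eq_card => d; rewrite !inE e1 -(colourP _ FFs cF) inE.
rewrite card_darts //; have /eqP := walk_balance u wc0; rewrite eqn_add2r => /eqP <-.
by rewrite addnn mul2n -e2 count_map.
Qed.

(** This is the hypothesis [q_cyc] of the detachment. The colour [set0] consists of the 1-factor if
    [r] is odd and of no edge otherwise; any further colour that is not a cycle is empty. *)
Lemma colour_degree_bound k u :
  if cycle_class k then (colour_degree k u == 0) || (colour_degree k u == 2)
  else colour_degree k u <= 1.
Proof.
case: ifP => [/cycle_classP[F [c [FFs cF cyc ->]]]|nk].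
  rewrite (cycle_degree _ FFs) //; case/and4P: cyc => _ /count_uniq_mem-> _ _.
  by case: (_ \in _).
have [k0|kn0] := eqVneq k set0; last first.
  rewrite (_ : colour_degree k u = 0) //; apply/eqP; rewrite cards_eq0; apply/eqP/setP=> d.
  rewrite !inE; apply/negP=> /andP[/eqP ck _]; move: nk kn0; rewrite -ck /colour.
  by case: pickP => [k' /andP[/= -> ] //|_]; rewrite /= eqxx.
have [_ _] := FsP; case: ifP => _ => [[I fI dec]|dec].
  rewrite -(fI u) (degree_darts (psi := id) (tl := en)) //; last by exists id.
  apply: eq_leq; apply: eq_card => d; by rewrite !inE k0 -(colour_one_factor _ dec).
rewrite (_ : colour_degree k u = 0) //; apply/eqP; rewrite cards_eq0; apply/eqP/setP=> d.
by rewrite !inE k0 colour0 has_count dec.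
Qed.

Notation E := (edge G * 'I_m)%type.

(** The whole weight [m] of a part sits on its vertex of index 0. The [lam * m] edges of a pair, in
    [m] copies each, give the required [lam * (m * m)]. *)
Lemma initial_detachment :
  detachment lam (fun d : E * bool => en (d.1.1, d.2)) (fun e : E => colour e.1)
    colour_degree cycle_class
    (fun x => if x.2 == Ordinal m_gt0 then m else 0)
    (fun d => (en (d.1.1, d.2), Ordinal m_gt0)).
Proof.
have en_flip := en_neq endsE; set a0 := Ordinal m_gt0.
split=> //= [[u a] [v b] /= uv|k [u a]|k ck] /=.
- have [[/eqP-> /eqP->]|nab] := @andP (a == a0) (b == a0); last first.
    rewrite [RHS](_ : _ = 0); last by case: eqP nab; case: eqP; rewrite ?muln0 // => _ _ [].
    apply/eqP; rewrite cards_eq0; apply/eqP/setP=> d; rewrite !inE !xpair_eqE.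
    by apply/negP=> /andP[/andP[_ bE] /andP[_ aE]]; case: nab; rewrite eq_sym aE eq_sym bE.
  rewrite eqxx mulnA -(multG uv) mulnC.
  transitivity (m * #|[set d : edge G * bool | (en (flip d) == v) && (en d == u)]|).
    rewrite -card_dart_copies; apply: eq_card => d.
    by rewrite !inE !xpair_eqE eqxx !andbT.
  by rewrite (card_darts_between en_flip uv); apply/congr1/eq_card => e; rewrite !inE endsE.
- have [->|na] := eqVneq a a0.
    rewrite mulnC -card_dart_copies; apply: eq_card => d.
    by rewrite !inE xpair_eqE eqxx andbT.
  rewrite muln0; apply/eqP; rewrite cards_eq0; apply/eqP/setP=> d.
  by rewrite !inE xpair_eqE [a0 == a]eq_sym (negbTE na) !andbF.
- have /cycle_classP[F [c [FFs cF cyc ->]]] := ck.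
  have [y [c0 [wc0 e1 e2]]] := cycle_trail endsE cyc.
  (* [copy i] runs once round the cycle on the edges with index [i]; the trail joins these rounds
     for all [i]. *)
  pose copy (i : 'I_m) := [seq ((d.1, i), d.2) | d : edge G * bool <- c0].
  exists (y, a0), (flatten [seq copy i | i <- enum 'I_m]).
  have e12 : unzip1 (flatten [seq copy i | i <- enum 'I_m]) =
             [seq (e, i) | i <- enum 'I_m, e <- unzip1 c0].
    rewrite /unzip1 map_flatten -map_comp; congr flatten; apply: eq_map => i /=.
    by rewrite -!map_comp.
  split.
  + apply: walk_flatten; apply/allP=> _ /mapP[i _ ->]; move: wc0; rewrite /copy.
    elim: c0 {1 3}y {e1 e2 e12 copy} => [|d p IHp] z /=; first by move/eqP->.
    by case/andP=> /eqP <- /IHp->; rewrite -surjective_pairing eqxx.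
  + rewrite e12; apply: allpairs_uniq; rewrite ?enum_uniq //.
      by rewrite e1; case/and4P: cyc.
    by move=> [i e] [i' e'] _ _ /= [-> ->].
  + case=> e i; rewrite e12 /= -(colourP _ FFs cF) inE -e1.
    apply/allpairsP/idP => [[[i' e'] [_ /= ? [-> _]]] //|ec].
    by exists (i, e); rewrite mem_enum.
Qed.

(** Once all weights are 1, the trail of a cycle [c] visits [(u, a)] as often as [c] visits [u],
    thus at most once. So it is a cycle of length [m * size c], and each 2-factor lifts to one of
    the multiplied type. *)
Lemma blowup_factorization : regular G r -> exists2 Fs',
  two_factorization (G := H) r Fs' /\ regular H r &
  forall F', F' \in Fs' -> has_type (G := H) F' [seq m * x | x <- T].
Proof.
move=> regG.
have en_flip := en_neq endsE.
have bv_flip (d : E * bool) : en ((flip d).1.1, (flip d).2) != en (d.1.1, d.2).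
  exact: (tl_flip_neq en_flip (d.1.1, d.2)).
have [|tl det] := detach_all bv_flip colour_degree_bound initial_detachment.
  by move=> u; rewrite -big_mkcond (big_pred1 (Ordinal m_gt0)).
have tl_part d : (tl d).1 = en (d.1.1, d.2) := detach_part det d.
have [|||psi bij_psi endsH] := @lambda_fold_edges lam (vertex G * 'I_m)%type E
    (fun x y => x.1 != y.1) tl.
- by move=> x; rewrite eqxx.
- by move=> [e i]; rewrite !tl_part.
- by move=> x y xy; rewrite (detach_mult det xy) !muln1.
have [psi' psiK psi'K] := bij_psi.
pose lift (F : {set edge G}) : {set edge H} := [set e | (psi' e).1 \in F].
(* The predicate [P] presents [F] as a union of colours; degrees in each colour survive the
   detachment, hence so do degrees in [F]. *)
have lift_degree (F : {set edge G}) (P : pred {set edge G}) (x : vertex H) :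
    (forall e, (e \in F) = P (colour e)) -> degree_in (lift F) x = degree_in F x.1.
  move=> FP; rewrite (degree_darts _ _ bij_psi endsH).
  rewrite (degree_darts (psi := id) F x.1 _ endsE); last by exists id.
  rewrite -!sum1_card (partition_big (fun d : E * bool => colour d.1.1) P) /=; last first.
    by move=> d; rewrite !inE psiK FP => /andP[].
  rewrite [RHS](partition_big (fun d : edge G * bool => colour d.1) P) /=; last first.
    by move=> d; rewrite !inE FP => /andP[].
  apply: eq_bigr => k Pk; rewrite !sum1dep_card.
  transitivity (colour_degree k x.1).
    rewrite -[RHS]muln1 -(detach_deg det); apply: eq_card => d; rewrite !inE psiK FP.
    by case: (eqVneq (colour d.1.1) k) => [->|]; rewrite ?andbF // Pk andbT.
  apply: eq_card => d; rewrite !inE FP.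
  by case: (eqVneq (colour d.1) k) => [->|]; rewrite ?andbF // Pk andbT.
have lift_dec s : decomposition s -> decomposition [seq lift F | F <- s].
  move=> dec e; rewrite count_map -[RHS](dec (psi' e).1); apply: eq_count => F /=.
  by rewrite inE.
exists [seq lift F | F <- Fs].
  have [sFs fFs decFs] := FsP; split; last first.
    move=> x; rewrite -(regG x.1) -(@lift_degree _ xpredT) //; last by move=> e; rewrite inE.
    by congr degree_in; apply/setP=> e; rewrite !inE.
  split=> [|_ /mapP[F FFs ->] x|].
  - by rewrite size_map.
  - by rewrite (lift_degree _ _ _ (fun e => colour_factor e FFs)) fFs.
  case: ifP decFs => _ => [[I fI dec]|dec]; last exact: lift_dec.
  exists (lift I); last exact: (lift_dec _ dec).
  move=> x; rewrite (lift_degree _ (pred1 set0)) // => e; exact: colour_one_factor.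
move=> _ /mapP[F FFs ->].
have [/allP cycF sizeF uF covF eF] := csP FFs.
have exc c : c \in cs F -> exists c' : seq (vertex H * edge H),
    [/\ is_cycle c', size c' = m * size c,
        forall x, count_mem x (unzip1 c') = count_mem x.1 (unzip1 c)
      & forall e, (e \in unzip2 c') = ((psi' e).1 \in unzip2 c)].
  move=> cF; have cyc := cycF c cF.
  have [y [c0 [wc0 e1 e2]]] := cycle_trail endsE cyc.
  have ck : cycle_class (edge_class c) by apply/cycle_classP; exists F, c.
  have [x [t [wt ut et]]] := detach_trail det ck.
  have cnt z : count (fun d => tl d == z) t = count_mem z.1 (unzip1 c).
    have := detach_deg det (edge_class c) z; rewrite muln1 (cycle_degree _ FFs cF).
    rewrite (_ : [set d : E * bool | _] =
      [set d : E * bool | (d.1 \in unzip1 t) && (tl d == z)]); last first.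
      by apply/setP=> d; rewrite !inE et.
    rewrite card_darts //; have /eqP := walk_balance z wt; rewrite eqn_add2r => /eqP <-.
    by rewrite addnn -mul2n => /eqP; rewrite eqn_pmul2l // => /eqP.
  pose c' : seq (vertex H * edge H) := [seq (tl d, psi d.1) | d <- t].
  have c'1 : unzip1 c' = map tl t by rewrite /unzip1 -map_comp.
  have c'2 : unzip2 c' = map psi (unzip1 t) by rewrite /unzip2 /unzip1 -!map_comp.
  have /and4P[c_gt1 uc1 uc2 _] := cyc.
  have sc' : size c' = m * size c.
    (* The length is found by counting darts: a trail has half as many steps as its edges have
       darts, and every edge of [c] has [m] copies. *)
    have ut2 := card_darts xpredT ut; rewrite !count_predT addnn in ut2.
    have uc0 : uniq (unzip1 c0) by rewrite e1.
    have uc02 := card_darts xpredT uc0; rewrite !count_predT addnn in uc02.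
    have sc0 : size c0 = size c.
      by have := congr1 size e1; rewrite /unzip1 /unzip2 !size_map.
    apply/double_inj; rewrite size_map -ut2 -sc0 -mul2n mulnCA mul2n -uc02.
    rewrite -card_dart_copies; apply: eq_card => d.
    by rewrite !inE !andbT et e1 -(colourP _ FFs cF) inE.
  exists c'; split=> // [|z|e].
  - apply/and4P; split.
    + by rewrite sc' (leq_trans c_gt1) // leq_pmull.
    + rewrite c'1; apply: count_mem_uniq => z; rewrite -has_pred1 has_count.
      rewrite count_map (_ : count _ t = (z.1 \in unzip1 c)); first by case: (_ \in _).
      by rewrite -(count_uniq_mem _ uc1) -cnt.
    + by rewrite c'2 map_inj_uniq //; apply: bij_inj.
    + rewrite cycle_map.
      case: t wt {ut et cnt c' c'1 c'2 sc'} => // d t wt.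
      have : walk tl (tl d) (d :: t) (tl d).
        by move: wt => /= /andP[/eqP <-]; rewrite eqxx.
      rewrite walk_cycle; apply: sub_cycle => d1 d2 /eqP d12.
      suff: ends (psi d1.1) == [set tl d1; tl d2] by [].
      by rewrite endsH -d12; apply/eqP/(pair_dart tl).
  - by rewrite c'1 count_map -cnt.
  - rewrite c'2 -{1}(psi'K e) mem_map; last exact: bij_inj.
    by rewrite et -(colourP _ FFs cF) inE.
have [c2c c2cP] := in_choice [::] exc.
(* A vertex of the blown-up graph is covered as often as its part is covered in [F], that is
   once. *)
have cnt x : count_mem x (unzip1 (flatten (map c2c (cs F)))) = 1.
  transitivity (count_mem x.1 (unzip1 (flatten (cs F)))); last first.
    by rewrite count_uniq_mem // covF.
  rewrite /unzip1 !map_flatten !count_flatten -!map_comp; congr sumn.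
  by apply/eq_in_map=> c cF; have [_ _ /(_ x)] := c2cP c cF.
exists (map c2c (cs F)); split.
- by apply/allP=> _ /mapP[c cF ->]; have [] := c2cP c cF.
- rewrite -map_comp; apply: perm_trans (perm_map _ sizeF); rewrite -map_comp.
  rewrite [X in perm_eq X](_ : _ = [seq m * size c | c <- cs F]) //.
  by apply/eq_in_map=> c cF; have [] := c2cP c cF.
- by apply: count_mem_uniq => x; rewrite -has_pred1 has_count cnt.
- by move=> x; rewrite -has_pred1 has_count cnt.
apply/setP=> e; rewrite [LHS]inE [RHS]inE {1}eF inE /unzip2 !map_flatten -!map_comp.
apply/flattenP/flattenP => -[_ /mapP[c cF ->] ec]; have [_ _ _ /(_ e) ece] := c2cP c cF.
  by exists (unzip2 (c2c c)); rewrite ?ece //; apply/mapP; exists c.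
by exists (unzip2 c); rewrite -?ece //; apply/mapP; exists c.
Qed.

End Blowup.

Theorem theorem6p1 (lam m n : nat) (T : seq nat)
    (hlam : 0 < lam) (hm : 0 < m) (hn : 0 < n) (hT : two_factor_type T) :
  OP_has_solution (complete_multigraph (lam * m) n) T ->
  OP_has_solution (complete_multipartite_multigraph lam n m)
    [seq m * x | x <- T].
Proof.
set G := complete_multigraph _ _; move=> [r [Fs [regG FsP typeFs]]].
have [cs csP] := in_choice [::] typeFs.
have [en endsE] := ex_ends G.
have multG (u v : vertex G) : u != v ->
    #|[set e : edge G | ends e == [set u; v]]| = lam * m.
  move=> uv; have uvP : adj_pair (fun u v : 'I_n => u != v) [set u; v].
    by apply/existsP; exists u; apply/existsP; exists v; rewrite uv eqxx.
  pose f l : edge G := (Sub [set u; v] uvP, l).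
  have fI : injective f by move=> l l' [].
  rewrite -[RHS]card_ord -(card_imset _ fI); apply: eq_card => -[A l].
  rewrite inE; apply/eqP/imsetP => [eA|[l' _ [-> _]] //].
  by exists l => //; congr (_, _); apply: val_inj.
have [Fs' [FsP' regH] typeFs'] := blowup_factorization hm multG FsP csP endsE regG.
(* As [vertex G] is ['I_n], the blown-up graph is the complete multipartite multigraph by
   conversion, and its degree is again [r]. *)
by exists r, Fs'.
Qed.
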